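(* (Nesting property for networks.) Let $G=(V,E)$ be a finite (oriented or unoriented) graph with edge capacities $w:E\to[0,\infty)$ and a distinguished set $\partial\subseteq V$ of boundary vertices, and let $A,B\subseteq\partial$ be disjoint. Then there exists a flow $f$ on $G$ that is simultaneously a max flow with respect to $A$ and a max flow with respect to $A\cup B$; that is, $f$ maximizes, among all flows on $G$, both the flux out of $A$ and the flux out of $A\cup B$.
   Context: Oriented case: each edge $e\in E$ has a direction and a capacity $w(e)\ge 0$. A flow is a function $f:E\to[0,\infty)$ with $f(e)\le w(e)$ for all $e\in E$ and, for every non-boundary vertex $v\in V\setminus\partial$, $\sum_{e\text{ into }v}f(e)=\sum_{e\text{ out of }v}f(e)$. No condition is imposed at boundary vertices. For a subset $R\subseteq\partial$, the flux of $f$ out of $R$ is $$\sum_{v\in R}\Big(\sum_{e\text{ out of }v}f(e)-\sum_{e\text{ into }v}f(e)\Big).$$ A max flow with respect to $R$ is a flow whose flux out of $R$ is maximal among all flows. Unoriented case: it is mapped to the oriented case by replacing each edge $e$ by two oppositely oriented edges $e_+$ and $e_-$, both of capacity $w(e)$. *)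

(* Defs.v *)
From HB Require Import structures.
From mathcomp Require Import all_boot all_order all_algebra.
From mathcomp Require Import reals.

Set Implicit Arguments.
Unset Strict Implicit.
Unset Printing Implicit Defensive.

Import Order.TTheory GRing.Theory Num.Theory.
Local Open Scope ring_scope.

(* Edges form a type of their own, so parallel edges and loops are allowed. *)
Record digraph (V E : finType) := Digraph { src : E -> V; tgt : E -> V }.

(* [ends e] lists the two endpoints of [e]; their order carries no meaning:
   exchanging them only swaps the names of the two copies of [e] in
   [oriented_double]. *)
Record ugraph (V E : finType) := UGraph { ends : E -> V * V }.

(* [(e, true)] is e_+ and [(e, false)] is e_-. *)
Definition oriented_double (V E : finType) (G : ugraph V E) :
    digraph V (E * bool)%type :=
  Digraph (fun a => if a.2 then (ends G a.1).1 else (ends G a.1).2)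
          (fun a => if a.2 then (ends G a.1).2 else (ends G a.1).1).

Definition double_capacity (R : realType) (E : finType) (w : E -> R) :
    E * bool -> R := fun a => w a.1.

Section Flows.
Variables (R : realType) (V E : finType) (G : digraph V E).

Definition inflow (f : E -> R) (v : V) : R := \sum_(e : E | tgt G e == v) f e.

Definition outflow (f : E -> R) (v : V) : R := \sum_(e : E | src G e == v) f e.

Definition is_flow (w : E -> R) (bd : {set V}) (f : E -> R) : Prop :=
  (forall e, 0 <= f e <= w e) /\
  (forall v, v \notin bd -> inflow f v = outflow f v).

Definition flux (f : E -> R) (S : {set V}) : R :=
  \sum_(v in S) (outflow f v - inflow f v).

Definition is_max_flow (w : E -> R) (bd S : {set V}) (f : E -> R) : Prop :=
  is_flow w bd f /\ (forall g, is_flow w bd g -> flux g S <= flux f S).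

End Flows.

(* Main.v *)
Require Import Defs.
From HB Require Import structures.
From mathcomp Require Import all_boot all_order all_algebra.
From mathcomp Require Import reals.
From mathcomp Require Import boolp classical_sets topology normedtype derive.
From mathcomp Require Import ring lra.

Set Implicit Arguments.
Unset Strict Implicit.
Unset Printing Implicit Defensive.

Import Order.TTheory GRing.Theory Num.Theory.
Local Open Scope ring_scope.

(** Among all flows pick, by compactness, one maximizing (flux out of A) + (flux
    out of A :|: B), that is, the excess weighted by 2 on A, 1 on B and 0 on the
    rest of the boundary. If this flow were not maximal for A (resp. A :|: B),
    a residual path would lead from that set to a boundary vertex outside it,
    which has smaller weight, and augmenting along the path would increase the
    weighted excess. *)

(** * Excess as a linear form on edge functions *)

Lemma sum_mul_delta (R : pzRingType) (I : finType) (p : I -> R) (i : I) :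
  \sum_j p j * (i == j)%:R = p i.
Proof.
rewrite (bigD1 i) //= eqxx mulr1 big1 ?addr0 // => j.
by rewrite eq_sym => /negPf ->; rewrite mulr0.
Qed.

Section Excess.
Variables (R : realType) (V E : finType) (G : digraph V E).

Definition excess (f : E -> R) (v : V) : R := outflow G f v - inflow G f v.

Lemma excessE f v :
  excess f v = \sum_e ((src G e == v)%:R - (tgt G e == v)%:R) * f e.
Proof.
rewrite /excess /outflow /inflow (big_mkcond (fun e => src G e == v)).
rewrite (big_mkcond (fun e => tgt G e == v)) -sumrB; apply: eq_bigr => e _.
by do 2!case: eqP => _; rewrite /=; ring.
Qed.

Lemma excessD f g v : excess (fun e => f e + g e) v = excess f v + excess g v.
Proof.
by rewrite !excessE -big_split /=; apply: eq_bigr => e _; rewrite -mulrDr.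
Qed.

Lemma excessZ a f v : excess (fun e => a * f e) v = a * excess f v.
Proof. by rewrite !excessE mulr_sumr; apply: eq_bigr => e _; ring. Qed.

(** Summation by parts: an edge enters only the excess at its two ends. The weighted excess thus
    becomes a linear form in [f], both for continuity and for comparing flows edge by edge. *)
Lemma sum_excess (p : V -> R) f :
  \sum_v p v * excess f v = \sum_e (p (src G e) - p (tgt G e)) * f e.
Proof.
under eq_bigr => v _ do rewrite excessE mulr_sumr.
rewrite exchange_big; apply: eq_bigr => e _ /=.
under eq_bigr => v _ do rewrite mulrA mulrBr.
rewrite -mulr_suml sumrB.
by rewrite !sum_mul_delta.
Qed.

Lemma fluxE f (S : {set V}) : flux G f S = \sum_v (v \in S)%:R * excess f v.
Proof.
rewrite /flux big_mkcond; apply: eq_bigr => v _.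
by case: ifP => _; rewrite (mul1r, mul0r).
Qed.

End Excess.

(** * Existence of a maximizer by compactness *)

Section MaxExistence.
Variables (R : realType) (V E : finType) (G : digraph V E).
Variables (w : E -> R) (bd : {set V}).

Import numFieldNormedType.Exports.
Local Open Scope classical_set_scope.

Local Notation edge_space := (prod_topology (fun _ : E => R)).

Lemma linear_form_continuous (c : E -> R) :
  continuous (fun f : edge_space => \sum_e c e * f e).
Proof.
apply: continuous_big => [|e _]; first exact: add_continuous.
move=> f; apply: continuous_comp; last exact: mulrl_continuous.
exact: (@proj_continuous E (fun=> R) e).
Qed.

(** By Tychonoff the box of the segments [[0, w e]] is compact; flows are cut out of it by the
    vanishing of continuous linear forms, one for each vertex outside [bd]. *)
Lemma flows_compact :
  compact ([set f | is_flow G w bd f] : set (edge_space)).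
Proof.
apply: (@subclosed_compact _ _
    [set f : edge_space | forall e, `[0, w e] (f e)]).
- have cap_closed e : closed ((fun f : edge_space => f e) @^-1` `[0, w e]).
    apply: preimage_closed; last exact: itv_closed.
    by move=> f _; exact: (@proj_continuous E (fun=> R) e).
  have cons_closed v : closed ((fun f : edge_space =>
      \sum_e ((src G e == v)%:R - (tgt G e == v)%:R) * f e) @^-1` [set x | x = 0]).
    apply: preimage_closed; last exact: closed_eq.
    by move=> f _; exact: linear_form_continuous.
  rewrite [X in closed X](_ : _ =
      \bigcap_(e in setT) ((fun f : edge_space => f e) @^-1` `[0, w e]) `&`
      \bigcap_(v in [set v | v \notin bd]) ((fun f : edge_space =>
        \sum_e ((src G e == v)%:R - (tgt G e == v)%:R) * f e) @^-1`
          [set x | x = 0])).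
    by apply: closedI; apply: closed_bigI.
  apply/seteqP; split => f /=.
    move=> [f_cap f_cons]; split => [e _|v v_bd] /=; first by rewrite in_itv /= f_cap.
    by rewrite -excessE /excess f_cons ?subrr.
  move=> [f_cap f_cons]; split => [e|v v_bd].
    by have := f_cap e I; rewrite /= in_itv.
  have /= := f_cons v v_bd; rewrite -excessE /excess => /eqP.
  by rewrite subr_eq0 => /eqP.
- apply: (@tychonoff E (fun=> R) (fun e => `[0, w e])) => e.
  exact: segment_compact.
- by move=> f [f_cap _] e /=; rewrite in_itv /= f_cap.
Qed.

Lemma exists_max_weighted_excess (w_ge0 : forall e, 0 <= w e) (p : V -> R) :
  exists2 f, is_flow G w bd f & forall g, is_flow G w bd g ->
    \sum_v p v * excess G g v <= \sum_v p v * excess G f v.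
Proof.
pose c e : R := p (src G e) - p (tgt G e).
(* The zero flow is admissible because capacities are nonnegative. *)
have flows0 : ([set f | is_flow G w bd f] : set edge_space) !=set0.
  exists (fun=> 0); split => [e|v _]; first by rewrite lexx w_ge0.
  by rewrite /inflow /outflow !big1.
have c_cont := continuous_subspaceT (linear_form_continuous (c := c)).
have [f] := compact_EVT_max flows0 flows_compact (@c_cont _).
rewrite inE => f_flow f_max; exists f => // g g_flow.
by rewrite !sum_excess; apply: f_max; rewrite inE.
Qed.

End MaxExistence.

(** * Residual graph, augmentation and cuts *)

Section Augmentation.
Variables (R : realType) (V E : finType) (G : digraph V E).
Variables (w : E -> R) (bd : {set V}) (f : E -> R).
Hypothesis f_flow : is_flow G w bd f.

Definition residual : rel V := fun x y =>
  [exists e, [&& src G e == x, tgt G e == y & f e < w e] ||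
             [&& tgt G e == x, src G e == y & 0 < f e]].

(** Directions along which a small positive step respects the capacity bounds. *)
Definition feasible_direction (d : E -> R) : Prop :=
  forall e, (0 < d e -> f e < w e) /\ (d e < 0 -> 0 < f e).

(** Add 1 on each edge used forwards and -1 on each edge used backwards; the excesses telescope
    along the path. The path may repeat edges, so [d] can take any integer value. *)
Lemma connect_direction x y : connect residual x y ->
  exists2 d, feasible_direction d &
    forall v, excess G d v = (x == v)%:R - (y == v)%:R.
Proof.
move=> /connectP[s]; elim: s x => [|z s IHs] x /=.
  move=> _ ->; exists (fun=> 0) => [e|v]; first by rewrite ltxx.
  by rewrite excessE subrr big1 // => e _; rewrite mulr0.
move=> /andP[/existsP[e0 xz] /IHs {}IHs] /IHs[d d_feas d_exc].
have e0_exc a v : excess G (fun e => a * (e == e0)%:R) v =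
    a * ((src G e0 == v)%:R - (tgt G e0 == v)%:R).
  rewrite excessZ excessE (bigD1 e0) //= eqxx mulr1 big1 ?addr0 // => e.
  by move=> /negPf ->; rewrite mulr0.
case/orP: xz => /and3P[/eqP xE /eqP zE room].
  exists (fun e => 1 * (e == e0)%:R + d e) => [e|v]; last first.
    by rewrite excessD e0_exc d_exc xE zE; ring.
  (* On [e0], [room] covers an increase; the sum is negative only if [d] already was, and then [neg]
     applies. *)
  case: eqP (d_feas e) => [->|_] [pos neg] /=.
    by split=> // ?; apply: (neg _); lra.
  by rewrite mulr0 add0r.
exists (fun e => -1 * (e == e0)%:R + d e) => [e|v]; last first.
  by rewrite excessD e0_exc d_exc xE zE; ring.
case: eqP (d_feas e) => [->|_] [pos neg] /=.
  by split=> // ?; apply: (pos _); lra.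
by rewrite mulr0 add0r.
Qed.

Lemma feasible_step d : feasible_direction d ->
  exists2 t, 0 < t & forall e, 0 <= f e + t * d e <= w e.
Proof.
move=> d_feas.
(* Slack in the direction of [d]; where [d e = 0] any positive value would do. *)
pose room e := if 0 < d e then w e - f e else if d e < 0 then f e else 1.
have room_gt0 e : 0 < room e.
  rewrite /room; have [pos neg] := d_feas e.
  by case: ifP => [/pos|_]; [rewrite subr_gt0|case: ifP => [/neg|]].
have den_gt0 e : 0 < 1 + `|d e| by rewrite ltr_pwDl.
(* The added 1 keeps the denominator positive when [d e = 0]; the default 1 keeps the minimum
   positive even without edges. *)
exists (\big[Num.min/1]_e (room e / (1 + `|d e|))).
  by apply: lt_bigmin => // e _; rewrite divr_gt0.
move=> e; set t := \big[_/_]_i _.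
have t_gt0 : 0 < t by apply: lt_bigmin => // i _; rewrite divr_gt0.
have : t <= room e / (1 + `|d e|) by exact: bigmin_le_cond.
rewrite ler_pdivlMr // mulrDr mulr1.
have /andP[f_ge0 f_le] := f_flow.1 e.
rewrite /room; case: ltrgt0P => [d_gt0|d_lt0|->] => ht.
- have : 0 < t * d e by rewrite mulr_gt0.
  by lra.
- have : 0 < t * - d e by rewrite mulr_gt0 // oppr_gt0.
  by lra.
- by rewrite mulr0 addr0 f_ge0.
Qed.

Lemma augment x y : x \in bd -> y \in bd -> connect residual x y ->
  exists2 g, is_flow G w bd g & exists2 t, 0 < t &
    forall v, excess G g v = excess G f v + t * ((x == v)%:R - (y == v)%:R).
Proof.
move=> x_bd y_bd /connect_direction[d d_feas d_exc].
have [t t_gt0 t_step] := feasible_step d_feas.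
have g_exc v : excess G (fun e => f e + t * d e) v =
    excess G f v + t * ((x == v)%:R - (y == v)%:R).
  by rewrite excessD excessZ d_exc.
exists (fun e => f e + t * d e); last by exists t.
split=> // v v_bd; apply/esym/eqP; rewrite -subr_eq0; apply/eqP.
rewrite -/(excess G _ v) g_exc /excess f_flow.2 // subrr.
(* Both ends of the path lie in [bd], so conservation at [v] is undisturbed. *)
have neq u : u \in bd -> (u == v) = false.
  by move=> u_bd; apply: contraNF v_bd => /eqP <-.
by rewrite !neq // subrr mulr0 addr0.
Qed.

(* The vertices reachable from S in the residual graph form a minimum cut. *)
Lemma no_residual_path_max (S : {set V}) : S \subset bd ->
    (forall x y, x \in S -> y \in bd -> connect residual x y -> y \in S) ->
  is_max_flow G w bd S f.
Proof.
move=> S_bd no_path; split=> // g g_flow.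
pose T := [set v | [exists x in S, connect residual x v]].
have T_step u v : u \in T -> residual u v -> v \in T.
  rewrite !inE => /exists_inP[x xS xu] uv; apply/exists_inP; exists x => //.
  exact/(connect_trans xu)/connect1.
(* [T] meets [bd] exactly in [S], and its other vertices have zero excess. *)
have flux_T h : is_flow G w bd h ->
    flux G h S = \sum_v (v \in T)%:R * excess G h v.
  move=> [_ h_cons]; rewrite fluxE; apply: eq_bigr => v _.
  have [v_bd|/h_cons v_cons] := boolP (v \in bd); last first.
    by rewrite /excess v_cons subrr !mulr0.
  congr (_%:R * _); congr nat_of_bool; apply/idP/idP => [vS|].
    by rewrite inE; apply/exists_inP; exists v.
  by rewrite inE => /exists_inP[x xS]; exact: no_path.
rewrite !flux_T // !sum_excess; apply: ler_sum => e _.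
have /andP[g_ge0 g_le] := g_flow.1 e.
have /andP[f_ge0 f_le] := f_flow.1 e.
(* Since [T] is closed under residual steps, [f] saturates the edges leaving [T] and vanishes on
   those entering it. *)
case: (boolP (src G e \in T)) => srcT; case: (boolP (tgt G e \in T)) => tgtT /=.
- by rewrite subrr !mul0r.
- rewrite subr0 !mul1r; apply: le_trans g_le _; rewrite leNgt.
  apply: contra tgtT => room; apply: T_step srcT _.
  by apply/existsP; exists e; rewrite !eqxx room.
- rewrite sub0r !mulN1r lerN2; apply: le_trans g_ge0; rewrite leNgt.
  apply: contra srcT => room; apply: T_step tgtT _.
  by apply/existsP; exists e; rewrite !eqxx room orbT.
- by rewrite subrr !mul0r.
Qed.

(** The last hypothesis makes [S] a superlevel set of [p] on [bd], so augmenting along a residual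
    path from [S] to the rest of [bd] gains [t * (p x - p y) > 0]. *)
Lemma max_weighted_excess_superlevel (p : V -> R) (S : {set V}) :
    (forall g, is_flow G w bd g ->
      \sum_v p v * excess G g v <= \sum_v p v * excess G f v) ->
    S \subset bd ->
    (forall x y, x \in S -> y \in bd -> y \notin S -> p y < p x) ->
  is_max_flow G w bd S f.
Proof.
move=> f_max S_bd p_lt; apply: no_residual_path_max => // x y xS y_bd xy.
apply: contraT => yS.
have [g /f_max + [t t_gt0 g_exc]] := augment (fintype.subsetP S_bd x xS) y_bd xy.
have -> : \sum_v p v * excess G g v =
    \sum_v p v * excess G f v + t * (p x - p y).
  rewrite -(sum_mul_delta p x) -(sum_mul_delta p y) -sumrB mulr_sumr -big_split /=.
  by apply: eq_bigr => v _; rewrite g_exc; ring.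
by rewrite gerDl leNgt mulr_gt0 // subr_gt0 p_lt.
Qed.

End Augmentation.

(** * Nested boundary sets and the two cases of the theorem *)

Lemma nested_max_flow (R : realType) (V E : finType) (G : digraph V E)
    (w : E -> R) (w_ge0 : forall e, 0 <= w e) (bd A C : {set V}) :
    A \subset C -> C \subset bd ->
  exists f, is_max_flow G w bd A f /\ is_max_flow G w bd C f.
Proof.
move=> AC C_bd.
(* This weight has both [A] and [C] as superlevel sets, so one maximizer serves both. *)
have [f f_flow f_max] := exists_max_weighted_excess G bd w_ge0
  (fun v => (v \in A)%:R + (v \in C)%:R).
exists f; split; apply: (max_weighted_excess_superlevel f_flow f_max) => //.
- exact: fintype.subset_trans C_bd.
- move=> x y xA _ /negPf yA; rewrite xA yA (fintype.subsetP AC x xA) /=.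
  by case: (y \in C) => /=; lra.
- move=> x y xC _ yC; have /negPf yA := contra (fintype.subsetP AC y) yC.
  by rewrite xC yA (negPf yC) /=; case: (x \in A) => /=; lra.
Qed.

Theorem mainTheorem2 (R : realType) (V E : finType) (w : E -> R)
    (w_ge0 : forall e, 0 <= w e) (bd A B : {set V})
    (A_bd : A \subset bd) (B_bd : B \subset bd) (AB_disj : [disjoint A & B]) :
  (forall G : digraph V E, exists f : E -> R,
      is_max_flow G w bd A f /\ is_max_flow G w bd (A :|: B) f) /\
  (forall G : ugraph V E, exists f : E * bool -> R,
      is_max_flow (oriented_double G) (double_capacity w) bd A f /\
      is_max_flow (oriented_double G) (double_capacity w) bd (A :|: B) f).
Proof.
have AAB : A \subset A :|: B by exact: finset.subsetUl.
have AB_bd : A :|: B \subset bd by rewrite finset.subUset A_bd.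
(* The unoriented case is the oriented one on [E * bool], whose capacities inherit nonnegativity
   from [w]. *)
by split=> G; apply: nested_max_flow => // e; exact: w_ge0.
Qed.
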